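(* Let $d\ge2$, let $\mathcal S\subseteq\mathcal U(d)$ be an ensemble with uniform distribution $\nu$ that is a unitary $t$-design with $t\ge2$, and let $C,D,E,F:\mathbb{C}^d\to\mathbb{C}^d$ be linear operators. Then $$\int_{\mathcal S}\operatorname{Tr}[WC]\operatorname{Tr}[W^\dagger D]\operatorname{Tr}[WE]\operatorname{Tr}[W^\dagger F]\,d\nu(W)=\int_{\mathcal U(d)}\operatorname{Tr}[WC]\operatorname{Tr}[W^\dagger D]\operatorname{Tr}[WE]\operatorname{Tr}[W^\dagger F]\,d\mu(W)$$ $$=\frac{1}{d^2-1}\big(\operatorname{Tr}[CD]\operatorname{Tr}[EF]+\operatorname{Tr}[CF]\operatorname{Tr}[ED]\big)-\frac{1}{d(d^2-1)}\big(\operatorname{Tr}[CDEF]+\operatorname{Tr}[CFED]\big).$$ Moreover, $$\int_{\mathcal U(d)}\big(\operatorname{Tr}[WC]\operatorname{Tr}[W^\dagger D]\big)^2\,d\mu(W)=\frac{2}{d^2-1}\big(\operatorname{Tr}[CD]\big)^2-\frac{1}{d(d^2-1)}\big(\operatorname{Tr}[(CD)^2]\big)^2.$$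
   Context: $\mathcal U(d)$ is the group of $d\times d$ unitary matrices and $\mu$ its normalized Haar measure. An ensemble $\mathcal S\subseteq\mathcal U(d)$ with uniform distribution $\nu$ is a unitary $t$-design if $\int_{\mathcal S}P(S)\,d\nu(S)=\int_{\mathcal U(d)}P(U)\,d\mu(U)$ for every polynomial $P$ of degree at most $t$ in the matrix entries of $U$ and at most $t$ in those of $U^\dagger$.
   Formalization: The last formula is false as printed (d=3, C=D=I: the integral is 2, the printed right side 15/8); its last term (1/(d(d²−1)))(Tr[(CD)²])² is replaced by (2/(d(d²−1)))Tr[(CD)²], the case E=C, F=D of the first formula. *)

(* Defs.v *)
From HB Require Import structures.
From mathcomp Require Import all_boot all_order all_algebra.
From mathcomp Require Import complex.
From mathcomp Require Import all_classical all_reals all_analysis.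
(* The notations of mpoly clash with those of MathComp-Analysis. *)
From mathcomp Require Import -(notations) mpoly.

Set Implicit Arguments.
Unset Strict Implicit.
Unset Printing Implicit Defensive.

Import Order.TTheory GRing.Theory Num.Theory.
Import numFieldNormedType.Exports.

Local Open Scope classical_set_scope.
Local Open Scope ring_scope.
Local Open Scope complex_scope.

(* R[i] gets the topology of its norm, like every numClosedFieldType; 'M[R[i]]_d
   then gets the product topology. *)
HB.instance Definition _ (R : rcfType) :=
  PseudoPointedMetric.copy R[i] (R[i] : numClosedFieldType).

Notation borel_mx R d := (g_sigma_algebraType (@open 'M[R[i]]_d)).

(* Borel measures on U(d) are represented by the Borel measures on 'M[R[i]]_d
   carried by the closed subset U(d). *)
Definition unitary_group (R : realType) (d : nat) : set (borel_mx R d) :=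
  [set U : 'M[R[i]]_d | U \is unitarymx].

Definition normalized_haar (R : realType) (d : nat)
    (mu : probability (borel_mx R d) R) : Prop :=
  mu (@unitary_group R d) = 1%E /\
  forall (V : 'M[R[i]]_d) (A : set (borel_mx R d)),
    V \is unitarymx -> measurable A -> A `<=` @unitary_group R d ->
    mu [set V *m U | U in A] = mu A.

(* All the points of S are equally likely. For a finite S this says exactly that
   nu is the normalized counting measure on S; for an infinite S it only forces
   all the points to be null, so that it is satisfied by whatever is called the
   uniform distribution on S (for instance Haar measure on S = U(d)). *)
Definition uniform_on (R : realType) (d : nat) (S : set (borel_mx R d))
    (nu : probability (borel_mx R d) R) : Prop :=
  nu S = 1%E /\
  forall U V : borel_mx R d, S U -> S V -> nu [set U] = nu [set V].

Definition complex_integral (disp : measure_display) (T : measurableType disp)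
    (R : realType) (mu : {measure set T -> \bar R}) (D : set T)
    (f : T -> R[i]) : R[i] :=
  (\int[mu]_(x in D) complex.Re (f x)) +i* (\int[mu]_(x in D) complex.Im (f x)).

(* Polynomials in the entries of U (the first d * d indeterminates) and in those
   of U^t* (the last d * d ones). *)
Definition entries (R : realType) (d : nat) (U : 'M[R[i]]_d) :
    'I_(d * d + d * d) -> R[i] :=
  row_mx (mxvec U) (mxvec (U^t*)%sesqui) 0.

Definition bidegree_le (R : realType) (d t : nat)
    (P : mpoly (d * d + d * d) R[i]) : Prop :=
  forall m, m \in msupp P ->
    (\sum_(k < d * d) m (lshift (d * d) k) <= t)%N /\
    (\sum_(k < d * d) m (rshift (d * d) k) <= t)%N.

Definition unitary_design (R : realType) (d t : nat)
    (mu : probability (borel_mx R d) R) (S : set (borel_mx R d))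
    (nu : probability (borel_mx R d) R) : Prop :=
  forall P : mpoly (d * d + d * d) R[i], bidegree_le t P ->
    complex_integral nu S (fun U => meval (entries U) P) =
    complex_integral mu (@unitary_group R d) (fun U => meval (entries U) P).

(* Main.v *)
(* Fix columns j1, j2, l1, l2. By left invariance of the Haar measure, the
   moments
     X i1 i2 k1 k2 = E[W_{i1 j1} W_{i2 j2} conj(W_{k1 l1}) conj(W_{k2 l2})]
   are the coefficients of an operator on C^d (x) C^d that commutes with every
   V (x) V. Diagonal phases, permutations and one rational rotation of a
   coordinate plane already force such an operator to be a combination of the
   identity and of the swap; its two coefficients are then read off from its
   traces against the identity and the swap, which W^* W = 1 determines. Summing
   X against the entries of C, D, E, F gives the four traces. The integrand is a
   polynomial of bidegree (2, 2), so a 2-design integrates it like mu does. *)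
Require Import Defs.
From HB Require Import structures.
From mathcomp Require Import all_boot all_order all_algebra.
From mathcomp Require Import perm complex.
From mathcomp Require Import all_classical all_reals all_analysis.
From mathcomp Require Import measurable_realfun ring.
From mathcomp Require Import -(notations) mpoly.

Set Implicit Arguments.
Unset Strict Implicit.
Unset Printing Implicit Defensive.

Import Order.TTheory GRing.Theory Num.Theory.
Import numFieldNormedType.Exports.

Local Open Scope classical_set_scope.
Local Open Scope ring_scope.

(** * Tensors invariant under V (x) V *)

Lemma sum_delta (A : pzSemiRingType) (I : finType) (f : I -> A) (a : I) :
  \sum_x (x == a)%:R * f x = f a.
Proof.
rewrite (bigD1 a)//= eqxx mul1r big1 ?addr0// => x /negbTE ->; exact: mul0r.
Qed.

Lemma sum_delta2 (A : pzSemiRingType) (I : finType) (f : I -> A) (c s : A)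
    (a b : I) :
  \sum_x (c * (x == a)%:R + s * (x == b)%:R) * f x = c * f a + s * f b.
Proof.
under eq_bigr do rewrite mulrDl -!mulrA.
by rewrite big_split/= -!mulr_sumr !sum_delta.
Qed.

(** Entrywise form of X = (V (x) V) X (V (x) V)^*, with [(i1, i2)] as row index and [(k1, k2)] as
    column index. Each factor is pulled out of the inner sums, so that the four sums can be
    evaluated one at a time. *)
Definition tensor2_invariant (C : numClosedFieldType) (n : nat)
    (X : 'I_n -> 'I_n -> 'I_n -> 'I_n -> C) : Prop :=
  forall V : 'M[C]_n, V \is unitarymx -> forall i1 i2 k1 k2,
    X i1 i2 k1 k2 =
    \sum_a V i1 a * \sum_b V i2 b * \sum_c (V k1 c)^* * \sum_e (V k2 e)^* *
      X a b c e.

Lemma unitarymx_coefP (C : numClosedFieldType) (n : nat) (V : 'M[C]_n) :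
  (forall i j, \sum_a V i a * (V j a)^* = (i == j)%:R) -> V \is unitarymx.
Proof.
move=> VV; apply/unitarymxP/matrixP => i j; rewrite !mxE -VV.
by apply: eq_bigr => a _; rewrite !mxE.
Qed.

(** One family covers both kinds of test matrices: diagonal phases ([s] the identity) and
    permutations ([v] constantly 1). *)
Lemma monomial_unitarymx (C : numClosedFieldType) (n : nat)
    (v : 'I_n -> C) (s : 'I_n -> 'I_n) :
  injective s -> (forall i, v i * (v i)^* = 1) ->
  \matrix_(i, a) (v i * (a == s i)%:R) \is unitarymx.
Proof.
move=> injs v1; apply: unitarymx_coefP => i j.
under eq_bigr do rewrite !mxE [v i * _]mulrC -mulrA.
rewrite sum_delta rmorphM/= conjC_nat (inj_eq injs).
by case: eqP => [->|_]; rewrite ?mulr1 ?v1// !mulr0.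
Qed.

Lemma monomial_invariant (C : numClosedFieldType) (n : nat)
    (X : 'I_n -> 'I_n -> 'I_n -> 'I_n -> C) (v : 'I_n -> C) (s : 'I_n -> 'I_n) :
  tensor2_invariant X -> injective s -> (forall i, v i * (v i)^* = 1) ->
  forall i1 i2 k1 k2, X i1 i2 k1 k2 =
    v i1 * v i2 * (v k1)^* * (v k2)^* * X (s i1) (s i2) (s k1) (s k2).
Proof.
move=> Xinv injs v1 i1 i2 k1 k2.
rewrite (Xinv _ (monomial_unitarymx injs v1)).
have E f i : \sum_a (\matrix_(i, a) (v i * (a == s i)%:R)) i a * f a =
    v i * f (s i) :> C.
  by under eq_bigr do rewrite mxE -mulrA; rewrite -mulr_sumr sum_delta.
have E' f i : \sum_a ((\matrix_(i, a) (v i * (a == s i)%:R)) i a)^* * f a =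
    (v i)^* * f (s i) :> C.
  under eq_bigr do rewrite mxE rmorphM/= conjC_nat -mulrA.
  by rewrite -mulr_sumr sum_delta.
by rewrite E E E' E' !mulrA.
Qed.

(* The phase 'i put on the single coordinate p multiplies X i1 i2 k1 k2 by the
   power of 'i whose exponent, between -2 and 2, is the number of p's among
   i1, i2 minus the number of p's among k1, k2. *)
Lemma invariant_eq0 (C : numClosedFieldType) (n : nat)
    (X : 'I_n -> 'I_n -> 'I_n -> 'I_n -> C) i1 i2 k1 k2 :
  tensor2_invariant X ->
  ~~ ((i1 == k1) && (i2 == k2) || (i1 == k2) && (i2 == k1)) ->
  X i1 i2 k1 k2 = 0.
Proof.
move=> Xinv.
pose v p (i : 'I_n) : C := if i == p then 'i else 1.
have v1 p i : v p i * (v p i)^* = 1.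
  rewrite /v; case: ifP => _; last by rewrite rmorph1 mulr1.
  by rewrite conjCi mulrN -expr2 sqrCi opprK.
have phase p : v p i1 * v p i2 * (v p k1)^* * (v p k2)^* != 1 ->
    X i1 i2 k1 k2 = 0.
  move=> v_neq1.
  have /eqP := monomial_invariant Xinv (@inj_id _) (v1 p) i1 i2 k1 k2.
  rewrite -subr_eq0 -{1}[X i1 i2 k1 k2]mul1r -mulrBl mulf_eq0 subr_eq0 eq_sym.
  by rewrite (negbTE v_neq1) => /eqP.
(* The nonzero exponents give only 'i, -'i and -1. A sign in place of 'i would miss exponent 2, as
   in [X p p q q]. *)
have N1_neq1 : -1 != 1 :> C by rewrite eqNr oner_eq0.
have i_neq1 : 'i != 1 :> C.
  apply: contraNneq N1_neq1 => i1E; apply/eqP.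
  by rewrite -(sqrCi C) i1E expr1n.
have Ni_neq1 : - 'i != 1 :> C.
  apply: contraNneq N1_neq1 => i1E; apply/eqP.
  by rewrite -(sqrCi C) -sqrrN i1E expr1n.
(* Each case picks a coordinate that does not occur equally often among [i1, i2] and among
   [k1, k2]. *)
have [i1k1|i1k1] := eqVneq i1 k1; last have [i1k2|i1k2] := eqVneq i1 k2.
- subst k1 => /=; rewrite negb_or => /andP[i2k2 _].
  have [i2i1|i2i1] := eqVneq i2 i1.
    subst i2; apply: (phase k2).
    by rewrite /v eqxx (negbTE i2k2) rmorph1 !mul1r conjCi.
  apply: (phase i2); rewrite /v eqxx [k2 == _]eq_sym [i1 == _]eq_sym.
  by rewrite (negbTE i2i1) (negbTE i2k2) rmorph1 mul1r !mulr1.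
- subst k2 => /= i2k1; have [i2i1|i2i1] := eqVneq i2 i1.
    subst i2; apply: (phase k1).
    by rewrite /v eqxx (negbTE i2k1) rmorph1 !mul1r conjCi mulr1.
  apply: (phase i2); rewrite /v eqxx [k1 == _]eq_sym [i1 == _]eq_sym.
  by rewrite (negbTE i2i1) (negbTE i2k1) rmorph1 mul1r !mulr1.
- move=> _; apply: (phase i1).
  rewrite /v eqxx ![_ == i1]eq_sym (negbTE i1k1) (negbTE i1k2) rmorph1 !mulr1.
  by case: ifP => _; rewrite ?mulr1// -expr2 sqrCi.
Qed.

Lemma perm_invariant (C : numClosedFieldType) (n : nat)
    (X : 'I_n -> 'I_n -> 'I_n -> 'I_n -> C) (s : 'I_n -> 'I_n) :
  tensor2_invariant X -> injective s ->
  forall i1 i2 k1 k2, X i1 i2 k1 k2 = X (s i1) (s i2) (s k1) (s k2).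
Proof.
move=> Xinv injs i1 i2 k1 k2.
by rewrite (@monomial_invariant _ _ _ (fun=> 1) s)// ?rmorph1 ?mul1r.
Qed.

(** A first transposition sends [p0] to [p]; a second one moves the image of [q0] to [q] and fixes
    [p], which differs from both. Values of an invariant tensor at distinct indices can thus be read
    at one reference pair. *)
Lemma two_transitive (n : nat) (p0 q0 p q : 'I_n) : p0 != q0 -> p != q ->
  exists s : 'I_n -> 'I_n, [/\ injective s, s p0 = p & s q0 = q].
Proof.
move=> pq0 pq; pose t := tperm p0 p.
exists (fun x => tperm (t q0) q (t x)); split.
- exact: inj_comp perm_inj perm_inj.
- rewrite /t tpermL tpermD// 1?eq_sym//.
  by rewrite -{1}(tpermL p0 p) (inj_eq perm_inj).
- by rewrite tpermL.
Qed.

(** The triple 3, 4, 5 gives a rotation with rational entries: conjugation fixes them, and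
    orthonormality is rational arithmetic. *)
Lemma rotation_unitarymx (C : numClosedFieldType) (n : nat) (p q : 'I_n) :
  p != q ->
  \matrix_(i, a) (if i == p then 3/5 * (a == p)%:R + 4/5 * (a == q)%:R
    else if i == q then - (4/5) * (a == p)%:R + 3/5 * (a == q)%:R
    else (a == i)%:R) \is @unitarymx C n n.
Proof.
move=> pq; apply: unitarymx_coefP => i j.
under eq_bigr do rewrite !mxE.
have [ip|ip] := eqVneq i p; last have [iq|iq] := eqVneq i q.
- rewrite ?ip sum_delta2 /= !eqxx [q == p]eq_sym (negbTE pq).
  have [jp|jp] := eqVneq j p; last have [jq|jq] := eqVneq j q.
  + by rewrite ?jp ?eqxx !rmorphD !rmorphM/= !fmorphV/= !conjC_nat; field.
  + rewrite ?jq ?(negbTE pq) !rmorphD !rmorphM/= rmorphN/= !rmorphM !fmorphV/=.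
    by rewrite !conjC_nat; field.
  + by rewrite rmorph0 !mulr0 addr0.
- rewrite ?iq sum_delta2 /= !eqxx [q == p]eq_sym (negbTE pq).
  have [jp|jp] := eqVneq j p; last have [jq|jq] := eqVneq j q.
  + rewrite ?jp 1?eq_sym ?(negbTE pq) !rmorphD !rmorphM/= !fmorphV/= !conjC_nat.
    by field.
  + rewrite ?jq ?eqxx !rmorphD !rmorphM/= rmorphN/= !rmorphM !fmorphV/=.
    by rewrite !conjC_nat; field.
  + by rewrite rmorph0 !mulr0 addr0.
- rewrite sum_delta /=.
  have [jp|jp] := eqVneq j p; last have [jq|jq] := eqVneq j q.
  + by rewrite ?jp (negbTE ip) (negbTE iq) !mulr0 addr0 rmorph0.
  + by rewrite ?jq (negbTE ip) (negbTE iq) !mulr0 addr0 rmorph0.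
  + by rewrite conjC_nat.
Qed.

(** With c = 3/5, s = 4/5 and x, y, z the three values in the statement, invariance reads x = (c^4 +
    s^4) x + 2 c^2 s^2 (y + z). Since 1 - c^4 - s^4 = 2 c^2 s^2 is nonzero, x = y + z. *)
Lemma rotation_invariant (C : numClosedFieldType) (n : nat)
    (X : 'I_n -> 'I_n -> 'I_n -> 'I_n -> C) (p q : 'I_n) :
  tensor2_invariant X -> p != q -> X p p p p = X p q p q + X p q q p.
Proof.
move=> Xinv pq.
have qp : q != p by rewrite eq_sym.
have [s [injs sp sq]] := two_transitive pq qp.
have Xs := perm_invariant Xinv injs.
have := Xinv _ (rotation_unitarymx C pq) p p p p.
set V := \matrix_(i, a) _.
have E f : \sum_a V p a * f a = 3/5 * f p + 4/5 * f q.
  by under eq_bigr do rewrite mxE eqxx; rewrite sum_delta2.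
have E' f : \sum_a (V p a)^* * f a = 3/5 * f p + 4/5 * f q.
  under eq_bigr do rewrite mxE eqxx rmorphD !rmorphM/= !fmorphV/= !conjC_nat.
  by rewrite sum_delta2.
rewrite !(E, E').
have X0 a b c e : ~~ ((a == c) && (b == e) || (a == e) && (b == c)) ->
    X a b c e = 0 by exact: invariant_eq0.
(* Of the 16 terms, the ten with unbalanced indices vanish; exchanging [p] and [q] reduces the other
   six to three values. *)
rewrite (X0 p p p q) ?(X0 p p q p) ?(X0 p p q q) ?(X0 p q p p) ?(X0 p q q q)
  ?(X0 q p p p) ?(X0 q p q q) ?(X0 q q p p) ?(X0 q q p q) ?(X0 q q q p)
  ?eqxx ?[q == p]eq_sym ?(negbTE pq)//.
rewrite (Xs q q q q) (Xs q p q p) (Xs q p p q) sp sq => H.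
(* 288/625 = 1 - (3/5)^4 - (4/5)^4 = 2 (3/5)^2 (4/5)^2 *)
apply: (@mulfI _ (288/625)); first by rewrite mulf_neq0 ?invr_eq0 ?pnatr_eq0.
move: H; set x := X p p p p; set y := X p q p q; set z := X p q q p => H.
rewrite (_ : 288/625 * x = x - (3/5) ^+ 4 * x - (4/5) ^+ 4 * x);
  last by field.
by rewrite {1}H; field.
Qed.

(** Up to permutation, only X p q p q, X p q q p and X p p p p can be nonzero, and the rotation
    makes the third the sum of the first two. The coefficients are therefore the first two values at
    a reference pair. *)
Lemma tensor2_commutant (C : numClosedFieldType) (n : nat)
    (X : 'I_n -> 'I_n -> 'I_n -> 'I_n -> C) :
  (2 <= n)%N -> tensor2_invariant X ->
  exists al be, forall i1 i2 k1 k2, X i1 i2 k1 k2 =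
    al * ((i1 == k1)%:R * (i2 == k2)%:R) + be * ((i1 == k2)%:R * (i2 == k1)%:R).
Proof.
move=> n2 Xinv; have n1 := ltnW n2.
pose p0 := Ordinal n1; pose q0 := Ordinal n2.
have pq0 : p0 != q0 by [].
exists (X p0 q0 p0 q0), (X p0 q0 q0 p0) => i1 i2 k1 k2.
have [i12|i12] := eqVneq i1 i2.
  subst i2; have [i1k1|i1k1] := eqVneq i1 k1; last first.
    rewrite !(mul0r, mulr0) addr0; apply: invariant_eq0 => //.
    by rewrite (negbTE i1k1) andbF.
  subst k1; have [i1k2|i1k2] := eqVneq i1 k2; last first.
    rewrite !(mul0r, mulr0) addr0; apply: invariant_eq0 => //.
    by rewrite (negbTE i1k2) andbF.
  subst k2; rewrite !mulr1.
  (* With all four indices equal both deltas are 1, so the value must be the sum of the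
     coefficients; the rotation relation needs a second index. *)
  have [q iq] : exists q, i1 != q.
    by have [->|] := eqVneq i1 p0; [exists q0|exists p0].
  have [s [injs sp sq]] := two_transitive pq0 iq.
  rewrite (rotation_invariant Xinv iq) (perm_invariant Xinv injs p0 q0 p0).
  by rewrite (perm_invariant Xinv injs p0 q0 q0) sp sq.
have [s [injs sp sq]] := two_transitive pq0 i12.
rewrite (perm_invariant Xinv injs p0 q0 p0) (perm_invariant Xinv injs p0 q0 q0).
rewrite sp sq.
have [nz|z] := boolP ((i1 == k1) && (i2 == k2) || (i1 == k2) && (i2 == k1)).
  case/orP: nz => /andP[/eqP <- /eqP <-]; rewrite !eqxx [i2 == i1]eq_sym.
    by rewrite (negbTE i12) !(mulr0,mulr1) addr0.
  by rewrite (negbTE i12) !(mulr0,mulr1) add0r.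
rewrite (invariant_eq0 Xinv z); move: z.
by rewrite negb_or -!natrM !mulnb => /andP[/negbTE -> /negbTE ->];
  rewrite !mulr0 addr0.
Qed.

(** The traces against the identity and the swap give u = al n^2 + be n and w = al n + be n^2, a
    system invertible for n >= 2. The factors 1/(n^2-1) and -1/(n(n^2-1)) are the Weingarten
    function of the symmetric group on two letters. *)
Lemma weingarten (C : numClosedFieldType) (n : nat)
    (X : 'I_n -> 'I_n -> 'I_n -> 'I_n -> C) (u w : C) :
  (2 <= n)%N -> tensor2_invariant X ->
  \sum_i \sum_k X i k i k = u -> \sum_i \sum_k X i k k i = w ->
  forall i1 i2 k1 k2, X i1 i2 k1 k2 =
    1 / (n%:R ^+ 2 - 1) * (u * ((i1 == k1)%:R * (i2 == k2)%:R) +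
                           w * ((i1 == k2)%:R * (i2 == k1)%:R)) -
    1 / (n%:R * (n%:R ^+ 2 - 1)) * (w * ((i1 == k1)%:R * (i2 == k2)%:R) +
                                    u * ((i1 == k2)%:R * (i2 == k1)%:R)).
Proof.
move=> n2 /(tensor2_commutant n2)[al [be XE]] Xu Xw i1 i2 k1 k2.
have card_sum (x : C) : \sum_(i < n) x = n%:R * x.
  by rewrite sumr_const card_ord mulr_natl.
have dd (i k : 'I_n) : (i == k)%:R * (k == i)%:R = (k == i)%:R * 1 :> C.
  by rewrite eq_sym mulr1 -natrM mulnb andbb.
have {}Xu : u = al * (n%:R * n%:R) + be * n%:R.
  rewrite -Xu; under eq_bigr => i _.
    under eq_bigr do rewrite XE !eqxx mulr1 dd.
    rewrite big_split/= -!mulr_sumr sum_delta card_sum; over.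
  by rewrite card_sum mulr1; ring.
have {}Xw : w = al * n%:R + be * (n%:R * n%:R).
  rewrite -Xw; under eq_bigr => i _.
    under eq_bigr do rewrite XE !eqxx mulr1 dd.
    rewrite big_split/= -!mulr_sumr sum_delta card_sum; over.
  by rewrite card_sum mulr1; ring.
have n0 : n%:R != 0 :> C by rewrite pnatr_eq0 -lt0n ltnW.
have n21 : n%:R ^+ 2 - 1 != 0 :> C.
  rewrite subr_eq0 -natrX -[1]/(1%:R) eqr_nat gtn_eqF//.
  by have := @ltn_exp2r 1 n 2 isT; rewrite exp1n n2 => ->.
rewrite XE Xu Xw.
set a := (i1 == k1)%:R * _; set b := (i1 == k2)%:R * _.
by field; rewrite n0 n21.
Qed.

(** * Contraction of index sums into traces *)

Lemma sum_delta4 (A : comPzRingType) (I : finType)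
    (f : I -> I -> I -> I -> A) (a b c e : I) :
  \sum_k1 \sum_l1 \sum_k2 \sum_l2 f k1 l1 k2 l2 *
    ((a == k1)%:R * (b == k2)%:R * ((c == l1)%:R * (e == l2)%:R)) = f a c b e.
Proof.
under eq_bigr => k1 _.
  under eq_bigr => l1 _.
    under eq_bigr => k2 _.
      under eq_bigr => l2 _.
        rewrite (_ : _ * _ = (l2 == e)%:R * ((k2 == b)%:R * ((l1 == c)%:R *
           ((k1 == a)%:R * f k1 l1 k2 l2)))); last first.
          rewrite ![a == _]eq_sym ![b == _]eq_sym ![c == _]eq_sym.
          by rewrite ![e == _]eq_sym; ring.
        over.
      rewrite sum_delta; over.
    rewrite sum_delta; over.
  rewrite sum_delta; over.
by rewrite sum_delta.
Qed.

Lemma sum4_mxtrace_mul (A : comPzRingType) (n : nat) (C D E F : 'M[A]_n) :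
  \sum_i1 \sum_j1 \sum_i2 \sum_j2
    C j1 i1 * E j2 i2 * (D i1 j1 * F i2 j2) = \tr (C *m D) * \tr (E *m F).
Proof.
rewrite /mxtrace; under [X in _ = X * _]eq_bigr do rewrite mxE.
under [X in _ = _ * X]eq_bigr do rewrite mxE.
rewrite exchange_big [X in _ = _ * X]exchange_big /= mulr_suml.
apply: eq_bigr => j1 _; rewrite mulr_suml; apply: eq_bigr => i1 _.
rewrite mulr_sumr; apply: eq_bigr => i2 _; rewrite mulr_sumr.
by apply: eq_bigr => j2 _; rewrite mulrACA.
Qed.

(** Exchanging [j1] and [j2] between [D] and [F] merges the two index cycles into one, j1, i1, j2,
    i2, j1, hence a single trace. *)
Lemma sum4_mxtrace_cycle (A : comPzRingType) (n : nat) (C D E F : 'M[A]_n) :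
  \sum_i1 \sum_j1 \sum_i2 \sum_j2
    C j1 i1 * E j2 i2 * (D i1 j2 * F i2 j1) = \tr (C *m D *m E *m F).
Proof.
rewrite /mxtrace exchange_big /=; apply: eq_bigr => j1 _.
rewrite mxE exchange_big /=; apply: eq_bigr => i2 _.
rewrite mxE mulr_suml exchange_big /=; apply: eq_bigr => j2 _.
rewrite mxE !mulr_suml; apply: eq_bigr => i1 _.
by rewrite mulrACA mulrA.
Qed.

(** * Measurability on the matrix space *)

Lemma mx_continuous (T : topologicalType) (U : topologicalType) m n
    (f : T -> 'M[U]_(m, n)) :
  (forall i j, continuous (fun x => f x i j)) -> continuous f.
Proof.
move=> cf x A [P xP PA].
have /filter_forall : forall i, nbhs x [set y | forall j, P i j (f y i j)].
  by move=> i; apply: filter_forall => j; exact: cf.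
by apply: filterS => y Py; apply: PA => i j; exact: Py.
Qed.

Lemma mulmx_continuous (K : numFieldType) m n p (V : 'M[K]_(m, n)) :
  continuous (fun U : 'M[K]_(n, p) => V *m U).
Proof.
apply: mx_continuous => i j.
rewrite (_ : (fun _ => _) = fun U : 'M[K]_(n, p) => \sum_k V i k * U k j).
  apply: (@continuous_big K _ +%R 0 xpredT) => [|k _].
    exact: (@add_continuous K).
  move=> U; apply: (@cvgM K _ (nbhs U) _ (fun=> V i k) (fun U => U k j)).
    exact: cvg_cst.
  exact: coord_continuous.
by apply/funext => U; rewrite mxE.
Qed.

Lemma measurable_mulmx (R : realType) d (V : 'M[R[i]]_d) :
  measurable_fun [set: borel_mx R d]
    (fun U : borel_mx R d => V *m U : borel_mx R d).
Proof.
apply: (@measurability _ _ (borel_mx R d) (borel_mx R d) setT _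
  (@open 'M[R[i]]_d)) => //.
move=> _ [B oB <-]; rewrite setTI; apply: sub_sigma_algebra.
have := @mulmx_continuous R[i] d d d V.
by move/continuousP; apply.
Qed.

Lemma measurable_continuous_borel_mx (R : realType) d (f : 'M[R[i]]_d -> R) :
  continuous f -> measurable_fun [set: borel_mx R d] (f : borel_mx R d -> R).
Proof.
move=> /continuousP cf.
apply: (measurability _ (RGenOpens.measurableE R)) => //.
move=> _ [_ [a [b ->] <-]]; rewrite setTI; apply: sub_sigma_algebra.
by apply: cf; exact: interval_open.
Qed.

Lemma Re_continuous (R : realType) : continuous (@complex.Re R).
Proof.
move=> z A /nbhs_ballP[e e0 eA].
(* Radii of balls in [R[i]] are elements of [R[i]], so the real radius is embedded. *)
apply/nbhs_ballP; exists (e%:C)%C; first by rewrite /= ltcR.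
move=> y zy; have {}zy : `|z - y| < (e%:C)%C := zy.
apply: eA; rewrite -ball_normE /=.
rewrite -ltcR; apply: le_lt_trans zy.
by rewrite (le_trans _ (normc_ge_Re _))// raddfB.
Qed.

(** Multiplication by i keeps the modulus and turns the imaginary part into minus a real part. *)
Lemma normc_ge_Im (R : rcfType) (z : R[i]) : (`|complex.Im z|%:C)%C <= `|z|.
Proof.
have := normc_ge_Re (z * 'i%C).
by rewrite ReiNIm normrN normrM complexiE normCi mulr1.
Qed.

Lemma Im_continuous (R : realType) : continuous (@complex.Im R).
Proof.
move=> z A /nbhs_ballP[e e0 eA].
apply/nbhs_ballP; exists (e%:C)%C; first by rewrite /= ltcR.
move=> y zy; have {}zy : `|z - y| < (e%:C)%C := zy.
apply: eA; rewrite -ball_normE /=.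
rewrite -ltcR; apply: le_lt_trans zy.
by rewrite (le_trans _ (normc_ge_Im _))// raddfB.
Qed.

(** Stated on real and imaginary parts because [complex_integral] integrates them separately. *)
Definition cmeasurable d (T : measurableType d) (R : realType)
    (f : T -> R[i]) : Prop :=
  measurable_fun setT (@complex.Re R \o f) /\
  measurable_fun setT (@complex.Im R \o f).

Lemma cmeasurable_cst d (T : measurableType d) (R : realType) (c : R[i]) :
  cmeasurable (fun _ : T => c).
Proof. by split; exact: measurable_cst. Qed.

Lemma cmeasurableD d (T : measurableType d) (R : realType) (f g : T -> R[i]) :
  cmeasurable f -> cmeasurable g -> cmeasurable (fun x => f x + g x).
Proof.
move=> [fr fi] [gr gi]; split.
  rewrite (_ : _ \o _ = (@complex.Re R \o f) \+ (@complex.Re R \o g)).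
    exact: measurable_funD.
  by apply/funext => x /=; rewrite raddfD.
rewrite (_ : _ \o _ = (@complex.Im R \o f) \+ (@complex.Im R \o g)).
  exact: measurable_funD.
by apply/funext => x /=; rewrite raddfD.
Qed.

Lemma cmeasurableM d (T : measurableType d) (R : realType) (f g : T -> R[i]) :
  cmeasurable f -> cmeasurable g -> cmeasurable (fun x => f x * g x).
Proof.
move=> [fr fi] [gr gi]; split.
  rewrite (_ : _ \o _ = ((@complex.Re R \o f) \* (@complex.Re R \o g)) \-
                        ((@complex.Im R \o f) \* (@complex.Im R \o g))).
    by apply: measurable_funB; exact: measurable_funM.
  by apply/funext => x /=; case: (f x) (g x) => [a b] [a' b'].
rewrite (_ : _ \o _ = ((@complex.Re R \o f) \* (@complex.Im R \o g)) \+
                      ((@complex.Im R \o f) \* (@complex.Re R \o g))).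
  by apply: measurable_funD; exact: measurable_funM.
by apply/funext => x /=; case: (f x) (g x) => [a b] [a' b'].
Qed.

Lemma cmeasurable_conj d (T : measurableType d) (R : realType) (f : T -> R[i]) :
  cmeasurable f -> cmeasurable (fun x => (f x)^*).
Proof.
move=> [fr fi]; split.
  rewrite (_ : _ \o _ = @complex.Re R \o f)//.
  by apply/funext => x /=; case: (f x).
rewrite (_ : _ \o _ = \- (@complex.Im R \o f)).
  exact: measurable_funN.
by apply/funext => x /=; case: (f x).
Qed.

Lemma cmeasurable_sum d (T : measurableType d) (R : realType) (I : Type)
    (r : seq I) (f : I -> T -> R[i]) :
  (forall i, cmeasurable (f i)) -> cmeasurable (fun x => \sum_(i <- r) f i x).
Proof.
move=> mf; elim: r => [|i r IH].
  rewrite (_ : (fun _ => _) = fun=> 0); first exact: cmeasurable_cst.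
  by apply/funext => x; rewrite big_nil.
rewrite (_ : (fun _ => _) = fun x => f i x + \sum_(j <- r) f j x).
  exact: cmeasurableD.
by apply/funext => x; rewrite big_cons.
Qed.

Lemma cmeasurable_coord (R : realType) n (i j : 'I_n) :
  cmeasurable (fun U : borel_mx R n => (U : 'M[R[i]]_n) i j).
Proof.
split; apply: measurable_continuous_borel_mx => U.
  apply: (@continuous_comp _ _ _ (fun U : 'M[R[i]]_n => U i j) (@complex.Re R)).
    exact: (@coord_continuous R[i]).
  exact: Re_continuous.
apply: (@continuous_comp _ _ _ (fun U : 'M[R[i]]_n => U i j) (@complex.Im R)).
  exact: (@coord_continuous R[i]).
exact: Im_continuous.
Qed.

Lemma cmeasurable_eq d (T : measurableType d) (R : realType) (f : T -> R[i])
    (c : R[i]) :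
  cmeasurable f -> measurable [set x | f x = c].
Proof.
move=> [fr fi]; rewrite (_ : [set _ | _] =
  ((@complex.Re R \o f) @^-1` [set complex.Re c]) `&`
  ((@complex.Im R \o f) @^-1` [set complex.Im c])).
  by apply: measurableI; rewrite -[X in measurable X]setTI;
    [apply: fr|apply: fi].
apply/seteqP; split => x /=; first by move=> ->.
by case: (f x) c => [a b] [a' b'] /= [-> ->].
Qed.

(** The equations U U^* = 1, entry by entry, present U(n) as a finite intersection of level sets of
    measurable functions. *)
Lemma measurable_unitary_group (R : realType) n :
  measurable (@unitary_group R n).
Proof.
rewrite (_ : @unitary_group R n = \bigcap_(i : 'I_n) \bigcap_(j : 'I_n)
    [set U : borel_mx R n | \sum_k (U : 'M[R[i]]_n) i k *
      ((U : 'M[R[i]]_n) j k)^* = (i == j)%:R]).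
  apply: fin_bigcap_measurable => // i _.
  apply: fin_bigcap_measurable => // j _.
  apply: cmeasurable_eq; apply: cmeasurable_sum => k.
  by apply: cmeasurableM; [|apply: cmeasurable_conj]; exact: cmeasurable_coord.
apply/seteqP; split => U /=.
  move=> /unitarymxP/matrixP UU i _ j _ /=; have := UU i j; rewrite !mxE => <-.
  by apply: eq_bigr => k _; rewrite !mxE.
move=> UU; apply/unitarymxP/matrixP => i j.
rewrite !mxE -(UU i Logic.I j Logic.I).
by apply: eq_bigr => k _; rewrite !mxE.
Qed.

(** * Integration over the unitary group *)

(* The entries of a matrix are bounded on U(n) only, hence the restriction of
   the bound to unitary matrices. *)
Definition bounded_cmeasurable (R : realType) n (f : borel_mx R n -> R[i]) :=
  cmeasurable f /\
  exists M : R[i], forall U : 'M[R[i]]_n, U \is unitarymx -> `|f U| <= M.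

Lemma bounded_cmeasurable_cst (R : realType) n (c : R[i]) :
  bounded_cmeasurable (fun _ : borel_mx R n => c).
Proof. by split; [exact: cmeasurable_cst|exists `|c|]. Qed.

Lemma bounded_cmeasurableM (R : realType) n (f g : borel_mx R n -> R[i]) :
  bounded_cmeasurable f -> bounded_cmeasurable g ->
  bounded_cmeasurable (fun U => f U * g U).
Proof.
move=> [mf [M fM]] [mg [N gN]]; split; first exact: cmeasurableM.
by exists (M * N) => U UU; rewrite normrM ler_pM ?fM ?gN.
Qed.

Lemma bounded_cmeasurable_conj (R : realType) n (f : borel_mx R n -> R[i]) :
  bounded_cmeasurable f -> bounded_cmeasurable (fun U => (f U)^*).
Proof.
move=> [mf [M fM]]; split; first exact: cmeasurable_conj.
by exists M => U UU; rewrite norm_conjC fM.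
Qed.

Lemma bounded_cmeasurableD (R : realType) n (f g : borel_mx R n -> R[i]) :
  bounded_cmeasurable f -> bounded_cmeasurable g ->
  bounded_cmeasurable (fun U => f U + g U).
Proof.
move=> [mf [M fM]] [mg [N gN]]; split; first exact: cmeasurableD.
by exists (M + N) => U UU; rewrite (le_trans (ler_normD _ _))// lerD ?fM ?gN.
Qed.

Lemma bounded_cmeasurable_sum (R : realType) n (I : Type) (r : seq I)
    (f : I -> borel_mx R n -> R[i]) :
  (forall i, bounded_cmeasurable (f i)) ->
  bounded_cmeasurable (fun U => \sum_(i <- r) f i U).
Proof.
move=> bf; elim: r => [|i r IH].
  under eq_fun do rewrite big_nil.
  exact: bounded_cmeasurable_cst.
under eq_fun do rewrite big_cons.
exact: bounded_cmeasurableD.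
Qed.

(** The squared modulus of the entry is one of the nonnegative terms of the squared norm of its row,
    which is 1. *)
Lemma unitarymx_coord_le1 (C : numClosedFieldType) n (U : 'M[C]_n) i j :
  U \is unitarymx -> `|U i j| <= 1.
Proof.
move=> /unitarymxP/matrixP/(_ i i); rewrite !mxE eqxx mulr1n => UU.
rewrite -(@expr_le1 _ 2)// -[leRHS]UU (bigD1 j)//= !mxE -normCK lerDl.
rewrite sumr_ge0// => k _.
by rewrite !mxE -normCK exprn_ge0.
Qed.

Lemma bounded_cmeasurable_coord (R : realType) n (i j : 'I_n) :
  bounded_cmeasurable (fun U : borel_mx R n => (U : 'M[R[i]]_n) i j).
Proof.
split; first exact: cmeasurable_coord.
by exists 1 => U; exact: unitarymx_coord_le1.
Qed.

Lemma bounded_cmeasurable_mulmx (R : realType) n (f : borel_mx R n -> R[i])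
    (V : 'M[R[i]]_n) : V \is unitarymx ->
  bounded_cmeasurable f -> bounded_cmeasurable (fun U => f (V *m U)).
Proof.
move=> VV [[fr fi] [M fM]]; split; last first.
  by exists M => U UU; exact: (fM _ (mul_unitarymx VV UU)).
split; first exact: (measurableT_comp fr (measurable_mulmx V)).
exact: (measurableT_comp fi (measurable_mulmx V)).
Qed.

Lemma bounded_cmeasurable_integrable (R : realType) n
    (mu : probability (borel_mx R n) R) (f : borel_mx R n -> R[i]) :
  bounded_cmeasurable f ->
  mu.-integrable (@unitary_group R n) (EFin \o (@complex.Re R \o f)) /\
  mu.-integrable (@unitary_group R n) (EFin \o (@complex.Im R \o f)).
Proof.
move=> [[fr fi] [M fM]].
have mU := @measurable_unitary_group R n.
have muU : (mu (@unitary_group R n) < +oo)%E.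
  by rewrite (le_lt_trans (probability_le1 mu mU))// ltry.
split; apply: measurable_bounded_integrable => //.
- exact: measurable_funTS.
(* The bound [M] is complex; the order of [R[i]] compares real parts and equates imaginary ones, so
   [complex.Re M] is a real bound. *)
- exists (complex.Re M); split; first exact: num_real.
  move=> x Mx U UU; apply: le_trans (ltW Mx); have := fM U UU.
  by move=> /(le_trans (normc_ge_Re _)); rewrite lecE => /andP[_].
- exact: measurable_funTS.
- exists (complex.Re M); split; first exact: num_real.
  move=> x Mx U UU; apply: le_trans (ltW Mx); have := fM U UU.
  by move=> /(le_trans (normc_ge_Im _)); rewrite lecE => /andP[_].
Qed.

Lemma complex_integralD (R : realType) n (mu : probability (borel_mx R n) R)
    (f g : borel_mx R n -> R[i]) :
  bounded_cmeasurable f -> bounded_cmeasurable g ->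
  complex_integral mu (@unitary_group R n) (fun U => f U + g U) =
  complex_integral mu (@unitary_group R n) f +
  complex_integral mu (@unitary_group R n) g.
Proof.
move=> /(bounded_cmeasurable_integrable mu)[fr fi].
move=> /(bounded_cmeasurable_integrable mu)[gr gi].
have mU := @measurable_unitary_group R n.
rewrite /complex_integral; apply/eqP; rewrite eq_complex /=.
rewrite -!RintegralD//.
by apply/andP; split; apply/eqP; apply: eq_Rintegral => U _ /=; rewrite raddfD.
Qed.

Lemma complex_integralZ (R : realType) n (mu : probability (borel_mx R n) R)
    (c : R[i]) (f : borel_mx R n -> R[i]) :
  bounded_cmeasurable f ->
  complex_integral mu (@unitary_group R n) (fun U => c * f U) =
  c * complex_integral mu (@unitary_group R n) f.
Proof.
move=> /(bounded_cmeasurable_integrable mu)[fr fi].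
have mU := @measurable_unitary_group R n.
have fZ (g : borel_mx R n -> R) a :
    mu.-integrable (@unitary_group R n) (EFin \o g) ->
    mu.-integrable (@unitary_group R n) (EFin \o (fun U => a * g U)).
  by move=> gi; have := integrableZl mU a gi.
case: c => a b; rewrite /complex_integral; apply/eqP; rewrite eq_complex /=.
rewrite -!RintegralZl// -RintegralB ?fZ// -RintegralD ?fZ//.
apply/andP; split; apply/eqP; apply: eq_Rintegral => U _ /=;
  by case: (f U).
Qed.

Lemma complex_integral_sum (R : realType) n (mu : probability (borel_mx R n) R)
    (I : Type) (r : seq I) (f : I -> borel_mx R n -> R[i]) :
  (forall i, bounded_cmeasurable (f i)) ->
  complex_integral mu (@unitary_group R n) (fun U => \sum_(i <- r) f i U) =
  \sum_(i <- r) complex_integral mu (@unitary_group R n) (f i).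
Proof.
move=> bf; elim: r => [|i r IH].
  rewrite big_nil; under eq_fun do rewrite big_nil.
  have := complex_integralZ mu 0 (bounded_cmeasurable_cst n (0 : R[i])).
  by rewrite !mul0r.
rewrite big_cons -IH; under eq_fun do rewrite big_cons.
exact/complex_integralD/bounded_cmeasurable_sum.
Qed.

Lemma unitarymx_mulVK (C : numClosedFieldType) n (V U : 'M[C]_n) :
  V \is unitarymx -> V *m ((V ^t*)%sesqui *m U) = U.
Proof. by move=> /unitarymxP VV; rewrite mulmxA VV mul1mx. Qed.

Lemma unitarymx_mulI (C : numClosedFieldType) n (V U : 'M[C]_n) :
  V \is unitarymx -> V *m U \is unitarymx -> U \is unitarymx.
Proof.
move=> VV VU; rewrite -[U]mul1mx.
have <- : (V ^t*)%sesqui *m V = 1%:M.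
  by rewrite -invmx_unitary// mulVmx// unitarymx_unit.
by rewrite -mulmxA mul_unitarymx// trmxC_unitary.
Qed.

(** Change of variables: on measurable subsets of U(n), the pushforward of [mu] by left
    multiplication by [V] is [mu] itself. *)
Lemma Rintegral_mulmx (R : realType) n (mu : probability (borel_mx R n) R)
    (V : 'M[R[i]]_n) (f : borel_mx R n -> R) :
  normalized_haar mu -> V \is unitarymx -> measurable_fun setT f ->
  mu.-integrable (@unitary_group R n) (EFin \o (fun U => f (V *m U))) ->
  \int[mu]_(U in @unitary_group R n) f (V *m U) =
  \int[mu]_(U in @unitary_group R n) f U.
Proof.
move=> [_ mu_inv] VV mf intf.
pose phi (U : borel_mx R n) : borel_mx R n := V *m U.
have mphi : measurable_fun setT phi := measurable_mulmx V.
have phiU : phi @^-1` (@unitary_group R n) = @unitary_group R n.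
  apply/seteqP; split => U UU; first exact: (unitarymx_mulI VV UU).
  exact: (mul_unitarymx VV UU).
have mU := @measurable_unitary_group R n.
have mphiA A : measurable A -> measurable (phi @^-1` A).
  by move=> mA; rewrite -[X in measurable X]setTI; exact: mphi.
have phiA A : A `<=` @unitary_group R n -> phi @^-1` A `<=` @unitary_group R n.
  by move=> AU; rewrite -[X in _ `<=` X]phiU; exact: preimage_subset.
(* Invariance is stated for images, the pushforward uses preimages; since [V] is invertible, the
   image of the preimage is the set itself. *)
have phiK A : [set V *m U | U in phi @^-1` A] = A.
  apply/seteqP; split => [_ [U AVU <-]|U AU]; first exact: AVU.
  exists ((V ^t*)%sesqui *m U); last exact: (unitarymx_mulVK U VV).
  by rewrite /phi /preimage /mkset (unitarymx_mulVK U VV).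
have intf' : mu.-integrable (phi @^-1` (@unitary_group R n))
    ((EFin \o f) \o phi).
  by rewrite phiU; exact: intf.
have mf' : measurable_fun setT (EFin \o f) by exact/measurable_EFinP.
have := integral_pushforward mphi mf' intf' mU.
rewrite phiU => push; congr fine; rewrite -[LHS]push.
apply: eq_measure_integral => A mA AU.
have := mu_inv V _ VV (mphiA A mA) (phiA A AU).
by rewrite phiK => muA; exact: esym muA.
Qed.

Lemma complex_integral_mulmx (R : realType) n
    (mu : probability (borel_mx R n) R) (V : 'M[R[i]]_n)
    (f : borel_mx R n -> R[i]) :
  normalized_haar mu -> V \is unitarymx -> bounded_cmeasurable f ->
  complex_integral mu (@unitary_group R n) (fun U => f (V *m U)) =
  complex_integral mu (@unitary_group R n) f.
Proof.
move=> haar VV bf; have [[fr fi] _] := bf.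
have [ifr ifi] :=
  bounded_cmeasurable_integrable mu (bounded_cmeasurable_mulmx VV bf).
rewrite /complex_integral.
by rewrite (Rintegral_mulmx haar VV fr)// (Rintegral_mulmx haar VV fi).
Qed.

(** * Fourth moments of the Haar measure *)

Lemma eq_complex_integral (R : realType) n (mu : probability (borel_mx R n) R)
    (f g : borel_mx R n -> R[i]) :
  (forall U : 'M[R[i]]_n, U \is unitarymx -> f U = g U) ->
  complex_integral mu (@unitary_group R n) f =
  complex_integral mu (@unitary_group R n) g.
Proof.
move=> fg; rewrite /complex_integral.
by congr Complex; apply: eq_Rintegral => U /set_mem UU; rewrite fg.
Qed.

Lemma complex_integral_cst (R : realType) n (mu : probability (borel_mx R n) R)
    (c : R[i]) :
  mu (@unitary_group R n) = 1%E ->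
  complex_integral mu (@unitary_group R n) (fun=> c) = c.
Proof.
move=> mu1; have mU := @measurable_unitary_group R n.
case: c => a b; rewrite /complex_integral !Rintegral_cst//.
by rewrite (_ : fine _ = 1) ?mulr1//; exact: (congr1 fine mu1).
Qed.

(** Unitarity is defined through rows; for a square matrix the right inverse is also a left inverse,
    which gives the columns. *)
Lemma unitarymx_col_orthonormal (C : numClosedFieldType) n (U : 'M[C]_n) j l :
  U \is unitarymx -> \sum_i U i j * (U i l)^* = (j == l)%:R.
Proof.
move=> UU; have UtU : (U ^t*)%sesqui *m U = 1%:M.
  by rewrite -invmx_unitary// mulVmx// unitarymx_unit.
have /matrixP/(_ l j) := UtU; rewrite !mxE eq_sym => <-.
by apply: eq_bigr => i _; rewrite !mxE mulrC.
Qed.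

(** Produces the nested shape shared by [tensor2_invariant] and [complex_integral_lin4]; [I] will be
    an index type or a type of index pairs. *)
Lemma mul4_suml (A : comPzRingType) (I : finType)
    (v1 v2 v3 v4 x1 x2 x3 x4 : I -> A) :
  (\sum_a v1 a * x1 a) * ((\sum_b v2 b * x2 b) *
    ((\sum_c v3 c * x3 c) * (\sum_e v4 e * x4 e))) =
  \sum_a v1 a * \sum_b v2 b * \sum_c v3 c * \sum_e v4 e *
    (x1 a * (x2 b * (x3 c * x4 e))).
Proof.
rewrite mulr_suml; apply: eq_bigr => a _; rewrite -mulrA; congr (_ * _).
rewrite mulr_suml mulr_sumr; apply: eq_bigr => b _.
rewrite -mulrA mulrCA; congr (_ * _).
rewrite mulr_suml !mulr_sumr; apply: eq_bigr => c _.
rewrite -mulrA [x2 b * _]mulrCA mulrCA; congr (_ * _).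
by rewrite !mulr_sumr; apply: eq_bigr => e _; rewrite !(mulrCA (v4 e)).
Qed.

Lemma bounded_cmeasurable_lin (R : realType) n (I : finType) (v : I -> R[i])
    (f : I -> borel_mx R n -> R[i]) :
  (forall i, bounded_cmeasurable (f i)) ->
  bounded_cmeasurable (fun U => \sum_i v i * f i U).
Proof.
move=> bf; apply: bounded_cmeasurable_sum => i.
apply: bounded_cmeasurableM => //.
exact: bounded_cmeasurable_cst.
Qed.

Lemma complex_integral_lin (R : realType) n (mu : probability (borel_mx R n) R)
    (I : finType) (v : I -> R[i]) (f : I -> borel_mx R n -> R[i]) :
  (forall i, bounded_cmeasurable (f i)) ->
  complex_integral mu (@unitary_group R n) (fun U => \sum_i v i * f i U) =
  \sum_i v i * complex_integral mu (@unitary_group R n) (f i).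
Proof.
move=> bf; rewrite complex_integral_sum => [|i].
  by apply: eq_bigr => i _; rewrite complex_integralZ.
by apply: bounded_cmeasurableM => //; exact: bounded_cmeasurable_cst.
Qed.

Lemma complex_integral_lin4 (R : realType) n (mu : probability (borel_mx R n) R)
    (I : finType) (v1 v2 v3 v4 : I -> R[i])
    (f : I -> I -> I -> I -> borel_mx R n -> R[i]) :
  (forall a b c e, bounded_cmeasurable (f a b c e)) ->
  complex_integral mu (@unitary_group R n) (fun U =>
    \sum_a v1 a * \sum_b v2 b * \sum_c v3 c * \sum_e v4 e * f a b c e U) =
  \sum_a v1 a * \sum_b v2 b * \sum_c v3 c * \sum_e v4 e *
    complex_integral mu (@unitary_group R n) (f a b c e).
Proof.
move=> bf; rewrite complex_integral_lin => [|a]; last first.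
  by do 3 (apply: bounded_cmeasurable_lin => ?).
apply: eq_bigr => a _; congr (_ * _); rewrite complex_integral_lin => [|b].
  apply: eq_bigr => b _; congr (_ * _); rewrite complex_integral_lin => [|c].
    by apply: eq_bigr => c _; congr (_ * _); rewrite complex_integral_lin.
  exact: bounded_cmeasurable_lin.
by do 2 (apply: bounded_cmeasurable_lin => ?).
Qed.

Definition quartic_monomial (R : realType) (n : nat)
    (i1 j1 i2 j2 k1 l1 k2 l2 : 'I_n) (U : borel_mx R n) : R[i] :=
  (U : 'M[R[i]]_n) i1 j1 * ((U : 'M[R[i]]_n) i2 j2 *
    (((U : 'M[R[i]]_n) k1 l1)^* * ((U : 'M[R[i]]_n) k2 l2)^*)).

Lemma bounded_quartic_monomial (R : realType) n
    (i1 j1 i2 j2 k1 l1 k2 l2 : 'I_n) :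
  bounded_cmeasurable (@quartic_monomial R n i1 j1 i2 j2 k1 l1 k2 l2).
Proof.
by do !apply: bounded_cmeasurableM; try apply: bounded_cmeasurable_conj;
  exact: bounded_cmeasurable_coord.
Qed.

Lemma haar_moment (R : realType) n (mu : probability (borel_mx R n) R)
    (i1 j1 i2 j2 k1 l1 k2 l2 : 'I_n) :
  (2 <= n)%N -> normalized_haar mu ->
  complex_integral mu (@unitary_group R n)
    (quartic_monomial i1 j1 i2 j2 k1 l1 k2 l2) =
    1 / (n%:R ^+ 2 - 1) *
      ((j1 == l1)%:R * (j2 == l2)%:R * ((i1 == k1)%:R * (i2 == k2)%:R) +
       (j1 == l2)%:R * (j2 == l1)%:R * ((i1 == k2)%:R * (i2 == k1)%:R)) -
    1 / (n%:R * (n%:R ^+ 2 - 1)) *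
      ((j1 == l2)%:R * (j2 == l1)%:R * ((i1 == k1)%:R * (i2 == k2)%:R) +
       (j1 == l1)%:R * (j2 == l2)%:R * ((i1 == k2)%:R * (i2 == k1)%:R)).
Proof.
move=> n2 haar; have [mu1 _] := haar.
pose X i1 i2 k1 k2 := complex_integral mu (@unitary_group R n)
  (quartic_monomial i1 j1 i2 j2 k1 l1 k2 l2).
have bX := fun a b c e => @bounded_quartic_monomial R n a j1 b j2 c l1 e l2.
(* Treats the traces against the identity and the swap together, [s] being the pairing of row
   indices. *)
have sumX (s : 'I_n -> 'I_n -> 'I_n * 'I_n) :
    \sum_i \sum_k X i k (s i k).1 (s i k).2 =
    complex_integral mu (@unitary_group R n) (fun U =>
      \sum_i \sum_k quartic_monomial i j1 k j2 (s i k).1 l1 (s i k).2 l2 U).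
  rewrite complex_integral_sum => [|i]; last exact: bounded_cmeasurable_sum.
  by apply: eq_bigr => i _; rewrite complex_integral_sum.
apply: (@weingarten _ _ X) => //.
- move=> V VV a1 a2 b1 b2.
  (* Substituting V U for U and expanding the four entries of V U gives the invariance of [X]. *)
  rewrite /X -(complex_integral_mulmx haar VV (bX _ _ _ _)).
  rewrite -complex_integral_lin4//; congr complex_integral.
  apply/funext => U; rewrite /quartic_monomial !mxE !rmorph_sum/=.
  under [X in _ * (_ * (X * _))]eq_bigr do rewrite rmorphM.
  under [X in _ * (_ * (_ * X))]eq_bigr do rewrite rmorphM.
  exact: mul4_suml.
- rewrite (sumX (fun i k => (i, k))) /=.
  rewrite -[RHS](complex_integral_cst _ mu1).
  apply: eq_complex_integral => U UU.
  rewrite -!(unitarymx_col_orthonormal _ _ UU) mulr_suml.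
  apply: eq_bigr => i _; rewrite mulr_sumr; apply: eq_bigr => k _.
  by rewrite /quartic_monomial; ring.
(* The crossed pairing contracts column [j1] with [l2] and [j2] with [l1]; the straight one above
   gave [j1] with [l1] and [j2] with [l2]. *)
- rewrite (sumX (fun i k => (k, i))) /=.
  rewrite -[RHS](complex_integral_cst _ mu1).
  apply: eq_complex_integral => U UU.
  rewrite -!(unitarymx_col_orthonormal _ _ UU) mulr_suml.
  apply: eq_bigr => i _; rewrite mulr_sumr; apply: eq_bigr => k _.
  by rewrite /quartic_monomial; ring.
Qed.

(** * Expansion of the traces into fourth moments *)

Lemma sum_pair (A : nmodType) (I : finType) (f : I * I -> A) :
  \sum_p f p = \sum_i \sum_j f (i, j).
Proof. by rewrite pair_bigA; apply: eq_bigr => -[]. Qed.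

Lemma mxtrace_mul_sum (A : comPzRingType) n (M N : 'M[A]_n) :
  \tr (M *m N) = \sum_p N p.2 p.1 * M p.1 p.2.
Proof.
rewrite sum_pair; apply: eq_bigr => i _; rewrite mxE.
by apply: eq_bigr => j _; rewrite mulrC.
Qed.

Lemma mxtrace_mul_adj_sum (C : numClosedFieldType) n (U M : 'M[C]_n) :
  \tr ((U ^t*)%sesqui *m M) = \sum_p M p.1 p.2 * (U p.1 p.2)^*.
Proof.
rewrite mxtrace_mulC sum_pair; apply: eq_bigr => i _; rewrite mxE.
by apply: eq_bigr => j _; rewrite !mxE.
Qed.

(** Rows and columns are paired independently, straight or crossed: [w1] weighs the two choices
    where the pairings agree, [w2] the two where they differ. *)
Lemma sum_weingarten (A : comPzRingType) (I : finType) (w1 w2 : A)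
    (f : I -> I -> I -> I -> A) (i1 j1 i2 j2 : I) :
  \sum_k1 \sum_l1 \sum_k2 \sum_l2 f k1 l1 k2 l2 *
    (w1 * ((j1 == l1)%:R * (j2 == l2)%:R * ((i1 == k1)%:R * (i2 == k2)%:R) +
           (j1 == l2)%:R * (j2 == l1)%:R * ((i1 == k2)%:R * (i2 == k1)%:R)) -
     w2 * ((j1 == l2)%:R * (j2 == l1)%:R * ((i1 == k1)%:R * (i2 == k2)%:R) +
           (j1 == l1)%:R * (j2 == l2)%:R * ((i1 == k2)%:R * (i2 == k1)%:R))) =
  w1 * (f i1 j1 i2 j2 + f i2 j2 i1 j1) - w2 * (f i1 j2 i2 j1 + f i2 j1 i1 j2).
Proof.
rewrite -!(sum_delta4 f); do 4 (rewrite -!big_split !mulr_sumr -sumrB /=;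
  apply: eq_bigr => ? _).
by ring.
Qed.

Lemma haar_moment_trace (R : realType) n (mu : probability (borel_mx R n) R)
    (C D E F : 'M[R[i]]_n) :
  (2 <= n)%N -> normalized_haar mu ->
  complex_integral mu (@unitary_group R n) (fun W =>
    \tr (W *m C) * \tr ((W^t*)%sesqui *m D) *
    \tr (W *m E) * \tr ((W^t*)%sesqui *m F)) =
  1 / (n%:R ^+ 2 - 1) *
    (\tr (C *m D) * \tr (E *m F) + \tr (C *m F) * \tr (E *m D)) -
  1 / (n%:R * (n%:R ^+ 2 - 1)) *
    (\tr (C *m D *m E *m F) + \tr (C *m F *m E *m D)).
Proof.
move=> n2 haar.
rewrite (_ : (fun W => _) = fun W : borel_mx R n =>
  \sum_a C a.2 a.1 * \sum_b E b.2 b.1 * \sum_c D c.1 c.2 * \sum_e F e.1 e.2 *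
    quartic_monomial a.1 a.2 b.1 b.2 c.1 c.2 e.1 e.2 W); last first.
  apply/funext => W; rewrite /quartic_monomial -mul4_suml -!mxtrace_mul_sum.
  by rewrite -!mxtrace_mul_adj_sum; ring.
rewrite complex_integral_lin4; last first.
  by move=> *; exact: bounded_quartic_monomial.
set w1 := 1 / _; set w2 := 1 / _.
pose f i1 j1 i2 j2 k1 l1 k2 l2 :=
  C j1 i1 * E j2 i2 * (D k1 l1 * F k2 l2).
transitivity (\sum_i1 \sum_j1 \sum_i2 \sum_j2
  (w1 * (f i1 j1 i2 j2 i1 j1 i2 j2 + f i1 j1 i2 j2 i2 j2 i1 j1) -
   w2 * (f i1 j1 i2 j2 i1 j2 i2 j1 + f i1 j1 i2 j2 i2 j1 i1 j2))).
  rewrite sum_pair; apply: eq_bigr => i1 _; apply: eq_bigr => j1 _.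
  rewrite sum_pair mulr_sumr; apply: eq_bigr => i2 _.
  rewrite mulr_sumr; apply: eq_bigr => j2 _; rewrite -(sum_weingarten w1 w2).
  rewrite mulrA sum_pair mulr_sumr; apply: eq_bigr => k1 _.
  rewrite mulr_sumr; apply: eq_bigr => l1 _.
  rewrite mulrA sum_pair mulr_sumr; apply: eq_bigr => k2 _.
  rewrite mulr_sumr; apply: eq_bigr => l2 _.
  by rewrite haar_moment// /f /= mulrA -[_ * _ * F k2 l2]mulrA.
(* Agreeing pairings give products of two traces, differing ones fourfold traces; within each kind
   the two terms differ by exchanging [D] and [F]. *)
rewrite -sum4_mxtrace_mul -[\tr (C *m F) * _]sum4_mxtrace_mul.
rewrite -sum4_mxtrace_cycle -[\tr (C *m F *m E *m D)]sum4_mxtrace_cycle.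
do 4 (rewrite -!big_split !mulr_sumr -sumrB /=; apply: eq_bigr => ? _).
by rewrite /f; ring.
Qed.

(** * Polynomials in the entries *)

(** Two separate bounds let bidegrees add up exactly: four traces of bidegrees (1, 0) and (0, 1)
    multiply to (2, 2), whereas a common bound 1 for each would only give 4. *)
Definition bidegree2_le n (A : nzRingType) (a b : nat) (P : mpoly (n + n) A) :=
  forall m, m \in msupp P ->
    (\sum_(k < n) m (lshift n k) <= a)%N /\
    (\sum_(k < n) m (rshift n k) <= b)%N.

Lemma bidegree2_leM n (A : nzRingType) a b a' b' (P Q : mpoly (n + n) A) :
  bidegree2_le a b P -> bidegree2_le a' b' Q ->
  bidegree2_le (a + a') (b + b') (P * Q).
Proof.
move=> Pab Qab m /msuppM_le/allpairsP[[p q] /= [/Pab[pa pb] /Qab[qa qb] ->]].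
split; under eq_bigr do rewrite mnmDE; by rewrite big_split leq_add.
Qed.

Lemma bidegree2_le_sum n (A : nzRingType) a b (I : Type) (r : seq I)
    (P : I -> mpoly (n + n) A) :
  (forall i, bidegree2_le a b (P i)) -> bidegree2_le a b (\sum_(i <- r) P i).
Proof.
move=> Pab; elim: r => [m|i r IH m]; first by rewrite big_nil msupp0.
by rewrite big_cons => /msuppD_le; rewrite mem_cat => /orP[/Pab|/IH].
Qed.

Lemma bidegree2_leZ n (A : nzRingType) a b (c : A) (P : mpoly (n + n) A) :
  bidegree2_le a b P -> bidegree2_le a b (c *: P).
Proof. by move=> Pab m /msuppZ_le/Pab. Qed.

Lemma bidegree2_le_lshift n (A : nzRingType) (k : 'I_n) :
  bidegree2_le 1 0 (mpolyX A (mnm1 (lshift n k))).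
Proof.
move=> m; rewrite msuppX inE => /eqP ->; split.
  under eq_bigr do rewrite mnm1E eq_lshift.
  by rewrite (bigD1 k)//= eqxx big1// => j /negbTE; rewrite eq_sym => ->.
by rewrite big1// => j _; rewrite mnm1E eq_lrshift.
Qed.

Lemma bidegree2_le_rshift n (A : nzRingType) (k : 'I_n) :
  bidegree2_le 0 1 (mpolyX A (mnm1 (rshift n k))).
Proof.
move=> m; rewrite msuppX inE => /eqP ->; split.
  by rewrite big1// => j _; rewrite mnm1E eq_rlshift.
under eq_bigr do rewrite mnm1E eq_rshift.
by rewrite (bigD1 k)//= eqxx big1// => j /negbTE; rewrite eq_sym => ->.
Qed.

(** The map [s] selects the block of indeterminates, that of U or that of its adjoint. *)
Definition trace_mpoly (R : realType) n (s : 'I_(n * n) -> 'I_(n * n + n * n))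
    (M : 'M[R[i]]_n) : mpoly (n * n + n * n) R[i] :=
  \sum_p M p.2 p.1 *: mpolyX R[i] (mnm1 (s (mxvec_index p.1 p.2))).

Lemma meval_trace_mpoly_lshift (R : realType) n (M U : 'M[R[i]]_n) :
  meval (entries U) (trace_mpoly (@lshift _ _) M) = \tr (U *m M).
Proof.
rewrite mxtrace_mul_sum rmorph_sum; apply: eq_bigr => -[i j] _ /=.
by rewrite mevalZ mevalXU /entries row_mxEl mxvecE.
Qed.

Lemma meval_trace_mpoly_rshift (R : realType) n (M U : 'M[R[i]]_n) :
  meval (entries U) (trace_mpoly (@rshift _ _) M) =
  \tr ((U^t*)%sesqui *m M).
Proof.
rewrite mxtrace_mul_sum rmorph_sum; apply: eq_bigr => -[i j] _ /=.
by rewrite mevalZ mevalXU /entries row_mxEr mxvecE.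
Qed.

Local Open Scope complex_scope.

(** In the last identity the subtracted term has the factor 2 and the trace of [(C *m D) ^+ 2] to
    the first power, where the English formula has the factor 1 and the square of that trace. Both
    sides must scale quadratically in [C], which that square would break. *)
Theorem lemma2 (R : realType) (d t : nat)
    (mu : probability (borel_mx R d) R)
    (S : set (borel_mx R d)) (nu : probability (borel_mx R d) R)
    (C D E F : 'M[R[i]]_d) :
  (2 <= d)%N -> (2 <= t)%N ->
  normalized_haar mu ->
  measurable S -> S `<=` @unitary_group R d -> uniform_on S nu ->
  unitary_design t mu S nu ->
  [/\ complex_integral nu S (fun W =>
        \tr (W *m C) * \tr ((W^t*)%sesqui *m D) *
        \tr (W *m E) * \tr ((W^t*)%sesqui *m F)) =
      complex_integral mu (@unitary_group R d) (fun W =>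
        \tr (W *m C) * \tr ((W^t*)%sesqui *m D) *
        \tr (W *m E) * \tr ((W^t*)%sesqui *m F)),
      complex_integral mu (@unitary_group R d) (fun W =>
        \tr (W *m C) * \tr ((W^t*)%sesqui *m D) *
        \tr (W *m E) * \tr ((W^t*)%sesqui *m F)) =
      1 / (d%:R ^+ 2 - 1) *
        (\tr (C *m D) * \tr (E *m F) + \tr (C *m F) * \tr (E *m D)) -
      1 / (d%:R * (d%:R ^+ 2 - 1)) *
        (\tr (C *m D *m E *m F) + \tr (C *m F *m E *m D)) &
      complex_integral mu (@unitary_group R d) (fun W =>
        (\tr (W *m C) * \tr ((W^t*)%sesqui *m D)) ^+ 2) =
      2 / (d%:R ^+ 2 - 1) * (\tr (C *m D)) ^+ 2 -
      2 / (d%:R * (d%:R ^+ 2 - 1)) * \tr ((C *m D) ^+ 2)].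
Proof.
move=> d2 t2 haar mS _ _ design; split.
- pose P := trace_mpoly (@lshift _ _) C * trace_mpoly (@rshift _ _) D *
    trace_mpoly (@lshift _ _) E * trace_mpoly (@rshift _ _) F.
  have PE : (fun W : borel_mx R d => \tr (W *m C) * \tr ((W^t*)%sesqui *m D) *
      \tr (W *m E) * \tr ((W^t*)%sesqui *m F)) = fun W => meval (entries W) P.
    apply/funext => W; rewrite !mevalM.
    by rewrite !meval_trace_mpoly_lshift !meval_trace_mpoly_rshift.
  rewrite PE; apply: design => m mP.
  have lP (M : 'M[R[i]]_d) :
      bidegree2_le 1 0 (trace_mpoly (@lshift (d * d) (d * d)) M).
    apply: bidegree2_le_sum => p; apply: bidegree2_leZ.
    exact: bidegree2_le_lshift.
  have rP (M : 'M[R[i]]_d) :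
      bidegree2_le 0 1 (trace_mpoly (@rshift (d * d) (d * d)) M).
    apply: bidegree2_le_sum => p; apply: bidegree2_leZ.
    exact: bidegree2_le_rshift.
  have [mC mD] := bidegree2_leM (bidegree2_leM (bidegree2_leM (lP C) (rP D))
    (lP E)) (rP F) mP.
  by split; [exact: leq_trans mC t2|exact: leq_trans mD t2].
- exact: haar_moment_trace.
(* Case E = C, F = D: the two products of traces coincide, and so do the two fourfold traces, whence
   both factors 2. *)
- rewrite (_ : (fun W => _) = fun W : borel_mx R d =>
      \tr (W *m C) * \tr ((W^t*)%sesqui *m D) *
      \tr (W *m C) * \tr ((W^t*)%sesqui *m D)); last first.
    by apply/funext => W; rewrite expr2 mulrA.
  rewrite haar_moment_trace// !expr2.
  have -> : (C *m D) * (C *m D) = C *m D *m C *m D.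
    by rewrite -[LHS]/(C *m D *m (C *m D)) mulmxA.
  set x := \tr (C *m D); set y := \tr _.
  by rewrite -!mulr2n -[x * x *+ 2]mulr_natl -[y *+ 2]mulr_natl; ring.
Qed.
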